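(* The group $\Gamma_d(q)$ has dead end elements of arbitrary depth with respect to the generating set $S_{d,q}$: for every positive integer $N$ there is a dead end element of $\Gamma_d(q)$ with respect to $S_{d,q}$ whose depth is at least $N$.
   Context: **The group.** $d\ge 2$ and $q\ge 2$ are integers such that either $d\in\{2,3\}$, or $d\ge4$ and every prime divisor of $q$ is greater than $d-1$. $\mathcal L_q$ is a commutative ring of order $q$ with unit $1$ containing distinct elements $\lambda_1,\dots,\lambda_{d-1}$ whose pairwise differences are invertible if $d\ge3$. Let $\mathcal R=\mathcal L_q[t,(t+\lambda_1)^{-1},\dots,(t+\lambda_{d-1})^{-1}]$. $\Gamma_d(q)$ is the group of matrices $\begin{pmatrix}(t+\lambda_1)^{k_1}\cdots(t+\lambda_{d-1})^{k_{d-1}}&P\\0&1\end{pmatrix}$ with $k_i\in\mathbb Z$, $P\in\mathcal R$. The generating set $S_{d,q}$ (closed under inverses) consists of the matrices $\begin{pmatrix}t+\lambda_i&b\\0&1\end{pmatrix}^{\pm1}$ ($b\in\mathcal L_q$, $1\le i\le d-1$) and $\begin{pmatrix}(t+\lambda_i)(t+\lambda_j)^{-1}&-b(t+\lambda_j)^{-1}\\0&1\end{pmatrix}$ ($b\in\mathcal L_q$, $i\ne j$ in $\{1,\dots,d-1\}$). **Dead ends.** Let $G$ be a group with finite generating set $S$ and word length $l$ with respect to $S$. An element $g\in G$ is a dead end element with respect to $S$ if $l(g)=n$ and $l(gs)\le n$ for all $s\in S\cup S^{-1}$. A dead end element $g$ with $l(g)=n$ has depth $k$ if $k$ is the largest integer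 such that $l(gs_1s_2\cdots s_r)\le n$ for all $1\le r<k$ and all choices of $s_1,\dots,s_r\in S\cup S^{-1}$. *)

(* Defs.v *)
From HB Require Import structures.
From mathcomp Require Import all_boot all_order all_algebra generic_quotient.
From mathcomp Require Import boolp classical_sets functions cardinality.
From mathcomp Require Import ring.
Set Implicit Arguments.
Unset Strict Implicit.
Unset Printing Implicit Defensive.

Import GRing.Theory.
Local Open Scope ring_scope.

Section DeadEnds.
Local Open Scope group_scope.
Variable G : groupType.
Implicit Types (S : set G) (g : G) (w : seq G).

(* The alphabet S \cup S^-1. *)
Definition letters S : set G := [set s | S s \/ S s^-1].

Definition word_over S w : Prop := forall s, s \in w -> letters S s.

Definition wprod w : G := \prod_(s <- w) s.

Record fin_gen_set := FinGenSet {
  gen_set :> set G;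
  gen_set_finite : finite_set gen_set;
  gen_set_generates : forall g, exists w, word_over gen_set w /\ wprod w = g
}.

Definition word_of_size S g (n : nat) : bool :=
  `[< exists w, [/\ size w = n, word_over S w & wprod w = g] >].

Lemma word_of_size_ex (S : fin_gen_set) g : exists n, word_of_size S g n.
Proof.
have [w [wS wg]] := gen_set_generates S g.
by exists (size w); apply/asboolP; exists w.
Qed.

Definition word_length (S : fin_gen_set) g : nat :=
  ex_minn (word_of_size_ex S g).

Definition dead_end (S : fin_gen_set) g : Prop :=
  forall s, letters S s -> (word_length S (g * s) <= word_length S g)%N.

Definition depth_bound (S : fin_gen_set) g (k : nat) : Prop :=
  forall w, word_over S w -> (1 <= size w < k)%N ->
    (word_length S (g * wprod w) <= word_length S g)%N.

Definition has_depth (S : fin_gen_set) g (k : nat) : Prop :=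
  depth_bound S g k /\ forall k', depth_bound S g k' -> (k' <= k)%N.

End DeadEnds.

(* [locpoly lam] is the localization L[t, (t + lam i)^-1, i : 'I_m]. A pair
   (p, k) stands for p / \prod_i (t + lam i)^(k i). Since the denominators are
   monic, they are regular even when L has zero divisors, so that the usual
   extra multiplier is not needed in the equivalence relation. *)
Module LocPoly.
Section LocPoly.
Variables (L : comNzRingType) (m : nat) (lam : 'I_m -> L).

Local Notation frac := ({poly L} * {ffun 'I_m -> nat})%type.

Definition den (k : {ffun 'I_m -> nat}) : {poly L} :=
  \prod_i ('X + (lam i)%:P) ^+ k i.

Lemma den0 : den 0 = 1.
Proof. by rewrite /den big1 // => i _; rewrite ffunE expr0. Qed.

Lemma denD k l : den (k + l) = den k * den l.
Proof.
by rewrite /den -big_split; apply: eq_bigr => i _; rewrite ffunE exprD.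
Qed.

Lemma den_reg k (p q : {poly L}) : p * den k = q * den k -> p = q.
Proof.
have mon : den k \is monic.
  by apply: monic_prod => i _; apply: monic_exp; apply: monicXaddC.
exact: (monic_rreg mon).
Qed.

Definition equiv (x y : frac) := x.1 * den y.2 == y.1 * den x.2.

Lemma equiv_refl : reflexive equiv. Proof. by move=> x; rewrite /equiv. Qed.

Lemma equiv_sym : symmetric equiv.
Proof. by move=> x y; rewrite /equiv eq_sym. Qed.

Lemma equiv_trans : transitive equiv.
Proof.
move=> y x z /eqP xy /eqP yz; apply/eqP/(@den_reg y.2).
by rewrite mulrAC xy mulrAC yz mulrAC.
Qed.

Canonical equiv_equiv := EquivRel equiv equiv_refl equiv_sym equiv_trans.

Definition type := {eq_quot equiv}%qT.
#[export] HB.instance Definition _ : EqQuotient _ equiv type := EqQuotient.on type.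
#[export] HB.instance Definition _ := Choice.on type.

Definition mk (p : {poly L}) (k : {ffun 'I_m -> nat}) : type := (\pi_type (p, k))%qT.

Lemma mkP p k q l : mk p k = mk q l <-> p * den l = q * den k.
Proof.
split=> [/eqmodP /= /eqP //|e]; apply/eqmodP => /=; exact/eqP.
Qed.

Lemma mkW (P : type -> Prop) : (forall p k, P (mk p k)) -> forall x, P x.
Proof. by move=> H; elim/quotW => -[p k]; exact: H. Qed.

Definition num (x : type) := (repr x).1.
Definition ex (x : type) := (repr x).2.

Lemma mk_repr x : mk (num x) (ex x) = x.
Proof. by rewrite /mk /num /ex -surjective_pairing reprK. Qed.

Lemma repr_mk p k : num (mk p k) * den k = p * den (ex (mk p k)).
Proof. by apply/mkP; rewrite mk_repr. Qed.

Definition add x y :=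
  mk (num x * den (ex y) + num y * den (ex x)) (ex x + ex y).
Definition mul x y := mk (num x * num y) (ex x + ex y).
Definition opp x := mk (- num x) (ex x).

Lemma mk_add p k q l : add (mk p k) (mk q l) = mk (p * den l + q * den k) (k + l).
Proof.
apply/mkP; rewrite !denD.
have := repr_mk p k; have := repr_mk q l.
move: (num (mk q l)) (den (ex (mk q l))) => c e.
move: (num (mk p k)) (den (ex (mk p k))) => a b h2 h1.
have -> : (a * e + c * b) * (den k * den l) =
  a * den k * e * den l + c * den l * b * den k by ring.
by rewrite h1 h2; ring.
Qed.

Lemma mk_mul p k q l : mul (mk p k) (mk q l) = mk (p * q) (k + l).
Proof.
by apply/mkP; rewrite !denD mulrACA !repr_mk; ring.
Qed.

Lemma mk_opp p k : opp (mk p k) = mk (- p) k.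
Proof. by apply/mkP; rewrite !mulNr repr_mk. Qed.

Lemma addA : associative add.
Proof.
elim/mkW=> p k; elim/mkW=> q l; elim/mkW=> r n; rewrite !mk_add addrA.
by congr mk; rewrite !denD; ring.
Qed.

Lemma addC : commutative add.
Proof.
elim/mkW=> p k; elim/mkW=> q l; rewrite !mk_add (addrC k).
by congr mk; ring.
Qed.

Lemma add0 : left_id (mk 0 0) add.
Proof. by elim/mkW=> p k; rewrite mk_add den0 mul0r !add0r mulr1. Qed.

Lemma addN : left_inverse (mk 0 0) opp add.
Proof.
by elim/mkW=> p k; rewrite mk_opp mk_add; apply/mkP; rewrite mulNr addNr !mul0r.
Qed.

#[export] HB.instance Definition _ := GRing.isZmodule.Build type addA addC add0 addN.

Lemma mulA : associative mul.
Proof.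
by elim/mkW=> p k; elim/mkW=> q l; elim/mkW=> r n; rewrite !mk_mul addrA mulrA.
Qed.

Lemma mulC : commutative mul.
Proof.
by elim/mkW=> p k; elim/mkW=> q l; rewrite !mk_mul (addrC k) (mulrC p).
Qed.

Lemma mul1 : left_id (mk 1 0) mul.
Proof. by elim/mkW=> p k; rewrite mk_mul mul1r add0r. Qed.

Lemma mulDl : left_distributive mul add.
Proof.
elim/mkW=> p k; elim/mkW=> q l; elim/mkW=> r n.
by rewrite !(mk_add, mk_mul); apply/mkP; rewrite !denD; ring.
Qed.

Lemma one_neq0 : mk 1 0 != mk 0 0.
Proof. by apply/eqP => /mkP/eqP; rewrite den0 !mulr1 oner_eq0. Qed.

#[export] HB.instance Definition _ :=
  GRing.Zmodule_isComNzRing.Build type mulA mulC mul1 mulDl one_neq0.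

(* Invertibility is made boolean classically, so that the ring inverse and
   integer powers of the t + lam i are available. *)
Definition unit : pred type := fun x => `[< exists y, y * x = 1 >].
Definition inv (x : type) : type :=
  if pselect (exists y, y * x = 1) is left h then projT1 (cid h) else x.

Lemma mulV : {in unit, left_inverse 1 inv *%R}.
Proof.
move=> x /asboolP h; rewrite /inv; case: pselect => // h'.
exact: (projT2 (cid h')).
Qed.

Lemma unitP (x y : type) : y * x = 1 -> unit x.
Proof. by move=> e; apply/asboolP; exists y. Qed.

Lemma inv_out : {in [predC unit], inv =1 id}.
Proof.
move=> x /negP h; rewrite /inv; case: pselect => // h'.
by case: h; apply/asboolP.
Qed.

#[export] HB.instance Definition _ :=
  GRing.ComNzRing_hasMulInverse.Build type mulV unitP inv_out.

End LocPoly.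
Module Exports. HB.reexport. End Exports.
End LocPoly.
Export LocPoly.Exports.

Notation locpoly lam := (LocPoly.type lam).

Section LocPolyTheory.
Variables (L : comNzRingType) (m : nat) (lam : 'I_m -> L).

Definition ofpoly (p : {poly L}) : locpoly lam := LocPoly.mk lam p 0.

Lemma ofpoly_zmod_morphism : zmod_morphism ofpoly.
Proof.
move=> p q; rewrite /ofpoly.
rewrite -[RHS]/(LocPoly.add _ (LocPoly.opp _)) LocPoly.mk_opp LocPoly.mk_add.
by rewrite LocPoly.den0 !mulr1 addr0.
Qed.
HB.instance Definition _ :=
  GRing.isZmodMorphism.Build {poly L} (locpoly lam) ofpoly ofpoly_zmod_morphism.

Lemma ofpoly_monoid_morphism : monoid_morphism ofpoly.
Proof.
split=> // p q; rewrite /ofpoly.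
by rewrite -[RHS]/(LocPoly.mul _ _) LocPoly.mk_mul addr0.
Qed.
HB.instance Definition _ :=
  GRing.isMonoidMorphism.Build {poly L} (locpoly lam) ofpoly
    ofpoly_monoid_morphism.

Lemma ofpoly_inj : injective ofpoly.
Proof. by move=> p q /LocPoly.mkP; rewrite LocPoly.den0 !mulr1. Qed.

Definition cst (b : L) : locpoly lam := ofpoly b%:P.
Definition tvar : locpoly lam := ofpoly 'X.
Definition tplus (i : 'I_m) : locpoly lam := tvar + cst (lam i).

Lemma tplusE i : tplus i = ofpoly ('X + (lam i)%:P).
Proof. by rewrite rmorphD. Qed.

Lemma ofpoly_den k : ofpoly (LocPoly.den lam k) = \prod_i tplus i ^+ k i.
Proof.
by rewrite rmorph_prod; apply: eq_bigr => i _; rewrite rmorphXn tplusE.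
Qed.

Lemma ofpoly_den_inv k : LocPoly.mk lam 1 k * ofpoly (LocPoly.den lam k) = 1.
Proof.
rewrite -[LHS]/(LocPoly.mul _ _) LocPoly.mk_mul addr0 mul1r.
by apply/LocPoly.mkP; rewrite LocPoly.den0 mulr1 mul1r.
Qed.

Lemma tplus_unit i : tplus i \is a GRing.unit.
Proof.
suff : \prod_j tplus j \is a GRing.unit.
  by move/unitr_prodP; apply.
apply/unitrPr; exists (LocPoly.mk lam 1 [ffun=> 1%N]).
rewrite mulrC -[RHS](ofpoly_den_inv [ffun=> 1%N]) ofpoly_den; congr (_ * _).
by apply: eq_bigr => j _; rewrite ffunE expr1.
Qed.

Lemma locpolyP (x : locpoly lam) :
  exists (p : {poly L}) (k : 'I_m -> nat), x = ofpoly p / \prod_i tplus i ^+ k i.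
Proof.
elim/LocPoly.mkW: x => p k; exists p, k.
rewrite -ofpoly_den.
have -> : (ofpoly (LocPoly.den lam k))^-1 = LocPoly.mk lam 1 k.
  by rewrite -[RHS](mulrK (x := ofpoly (LocPoly.den lam k))) ?ofpoly_den_inv
     ?mul1r //; apply/unitrPr; exists (LocPoly.mk lam 1 k);
     rewrite mulrC ofpoly_den_inv.
by rewrite -[RHS]/(LocPoly.mul _ _) LocPoly.mk_mul add0r mulr1.
Qed.

End LocPolyTheory.

Section Affine.
Variable R : comUnitRingType.

(* The matrix with rows (a, b) and (0, 1). *)
Definition affmx (a b : R) : 'M[R]_2 :=
  block_mx a%:M b%:M 0 1%:M : 'M[R]_(1 + 1).

Lemma affmxM a b a' b' :
  affmx a b *m affmx a' b' = affmx (a * a') (a * b' + b).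
Proof.
rewrite /affmx [LHS](@mulmx_block _ 1 1 1 1 1 1).
rewrite !mulmx0 !mul0mx !addr0 add0r mulmx1 mulmx1.
by rewrite -!scalar_mxM -raddfD.
Qed.

Lemma affmx1 : affmx 1 0 = 1%:M.
Proof. by rewrite /affmx raddf0 -scalar_mx_block. Qed.

Lemma affmx_inj a b a' b' : affmx a b = affmx a' b' -> a = a' /\ b = b'.
Proof.
move=> /(@eq_block_mx _ 1 1 1 1) [/matrixP/(_ 0 0) + /matrixP/(_ 0 0) + _ _].
by rewrite !mxE !eqxx !mulr1n.
Qed.

Lemma affmx_mulV a b : a \is a GRing.unit ->
  affmx a b *m affmx a^-1 (- (a^-1 * b)) = 1%:M.
Proof. by move=> ua; rewrite affmxM mulrV // mulrN mulVKr // addNr affmx1. Qed.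

Lemma affmx_unit a b : a \is a GRing.unit -> affmx a b \in unitmx.
Proof. by move=> /(affmx_mulV b) /mulmx1_unit[]. Qed.

Lemma affmxV a b : a \is a GRing.unit ->
  invmx (affmx a b) = affmx a^-1 (- (a^-1 * b)).
Proof.
by move=> ua; rewrite -[RHS](mulKmx (affmx_unit b ua)) affmx_mulV // mulmx1.
Qed.

End Affine.

Section Gamma.
Variables (L : finComUnitRingType) (m : nat) (lam : 'I_m -> L).
Local Notation R := (locpoly lam).

Definition tmon (k : 'I_m -> int) : R := \prod_i tplus lam i ^ k i.

Definition in_Gamma (A : 'M[R]_2) : Prop :=
  exists (k : 'I_m -> int) (P : R), A = affmx (tmon k) P.

Record Gamma := MkGamma { Gamma_mx :> 'M[R]_2; _ : `[< in_Gamma Gamma_mx >] }.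

HB.instance Definition _ := [isSub for Gamma_mx].
HB.instance Definition _ := [Choice of Gamma by <:].

Lemma GammaP (g : Gamma) : in_Gamma g. Proof. by case: g => A /= /asboolP. Qed.

Lemma tmonD k l : tmon (fun i => k i + l i) = tmon k * tmon l.
Proof.
rewrite /tmon -big_split; apply: eq_bigr => i _.
by rewrite exprzDr ?tplus_unit.
Qed.

Lemma tmon0 : tmon (fun=> 0) = 1.
Proof. by rewrite /tmon big1 // => i _; rewrite expr0z. Qed.

Lemma tmon_unit k : tmon k \is a GRing.unit.
Proof.
by apply/unitr_prodP => i _; case: (k i) => n; rewrite ?unitrV ?unitrX ?tplus_unit.
Qed.

Lemma tmonN k : tmon (fun i => - k i) = (tmon k)^-1.
Proof.
apply: (mulrI (tmon_unit k)); rewrite mulrV ?tmon_unit // -tmonD -tmon0.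
by apply: eq_bigr => i _; rewrite subrr.
Qed.

Lemma in_Gamma1 : in_Gamma 1%:M.
Proof. by exists (fun=> 0), 0; rewrite tmon0 affmx1. Qed.

Lemma in_GammaM A B : in_Gamma A -> in_Gamma B -> in_Gamma (A *m B).
Proof.
move=> [k [P ->]] [l [Q ->]]; exists (fun i => k i + l i), (tmon k * Q + P).
by rewrite affmxM tmonD.
Qed.

Lemma in_GammaV A : in_Gamma A -> in_Gamma (invmx A).
Proof.
move=> [k [P ->]]; exists (fun i => - k i), (- ((tmon k)^-1 * P)).
by rewrite affmxV ?tmon_unit // tmonN.
Qed.

Lemma in_Gamma_unit A : in_Gamma A -> A \in unitmx.
Proof.
by move=> [k [P ->]]; exact: affmx_unit (tmon_unit k).
Qed.

Definition Gamma_one : Gamma := MkGamma (asboolT in_Gamma1).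
Definition Gamma_mul (g h : Gamma) : Gamma :=
  MkGamma (asboolT (in_GammaM (GammaP g) (GammaP h))).
Definition Gamma_inv (g : Gamma) : Gamma :=
  MkGamma (asboolT (in_GammaV (GammaP g))).

Lemma Gamma_mulA : associative Gamma_mul.
Proof. by move=> g h k; apply/val_inj; rewrite /= mulmxA. Qed.
Lemma Gamma_mul1g : left_id Gamma_one Gamma_mul.
Proof. by move=> g; apply/val_inj; rewrite /= mul1mx. Qed.
Lemma Gamma_mulg1 : right_id Gamma_one Gamma_mul.
Proof. by move=> g; apply/val_inj; rewrite /= mulmx1. Qed.
Lemma Gamma_mulVg : left_inverse Gamma_one Gamma_inv Gamma_mul.
Proof.
by move=> g; apply/val_inj; rewrite /= mulVmx // in_Gamma_unit //; exact: GammaP.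
Qed.
Lemma Gamma_mulgV : right_inverse Gamma_one Gamma_inv Gamma_mul.
Proof.
by move=> g; apply/val_inj; rewrite /= mulmxV // in_Gamma_unit //; exact: GammaP.
Qed.

HB.instance Definition _ :=
  isGroup.Build Gamma Gamma_mulA Gamma_mul1g Gamma_mulg1 Gamma_mulVg Gamma_mulgV.

Definition gamma_gens : set Gamma := [set g : Gamma |
     (exists (i : 'I_m) (b : L), Gamma_mx g = affmx (tplus lam i) (cst lam b))
  \/ (exists (i : 'I_m) (b : L),
        Gamma_mx g = invmx (affmx (tplus lam i) (cst lam b)))
  \/ (exists (i j : 'I_m) (b : L), i != j /\
        Gamma_mx g = affmx (tplus lam i * (tplus lam j)^-1)
                           (- cst lam b * (tplus lam j)^-1))].

Lemma gamma_gens_finite : finite_set gamma_gens.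
Proof.
pose mx (x : ('I_m * L) + ('I_m * L) + ('I_m * 'I_m * L)) : 'M[R]_2 :=
  match x with
  | inl (inl (i, b)) => affmx (tplus lam i) (cst lam b)
  | inl (inr (i, b)) => invmx (affmx (tplus lam i) (cst lam b))
  | inr (i, j, b) => affmx (tplus lam i * (tplus lam j)^-1)
                           (- cst lam b * (tplus lam j)^-1)
  end.
pose f x : Gamma := insubd (1%g : Gamma) (mx x).
have fin : finite_set (f @` [set: ('I_m * L) + ('I_m * L) + ('I_m * 'I_m * L)]).
  by apply: finite_image; exact: finite_finset.
apply: sub_finite_set fin => g [[i [b e]]|[[i [b e]]|[i [j [b [_ e]]]]]].
- by exists (inl (inl (i, b))) => //; rewrite /f /= -e; exact: valKd.
- by exists (inl (inr (i, b))) => //; rewrite /f /= -e; exact: valKd.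
- by exists (inr (i, j, b)) => //; rewrite /f /= -e; exact: valKd.
Qed.

Lemma cst0 : cst lam 0 = 0. Proof. by rewrite /cst rmorph0. Qed.

(* For m = 0 the set gamma_gens is empty while Gamma is not trivial. *)
Section Generation.
Hypothesis m_gt0 : (0 < m)%N.

Let H (A : 'M[R]_2) : Prop := exists g : Gamma, Gamma_mx g = A /\
  exists w, word_over gamma_gens w /\ wprod w = g.

Let H1 : H 1%:M.
Proof.
exists 1%g; split=> //; exists [::]; split=> //; by rewrite /wprod big_nil.
Qed.

Let HM A B : H A -> H B -> H (A *m B).
Proof.
move=> [g [<- [w [wS wg]]]] [h [<- [v [vS vh]]]].
exists (g * h)%g; split=> //; exists (w ++ v); split.
  by move=> s; rewrite mem_cat => /orP[/wS|/vS].
by rewrite /wprod big_cat /=; congr (_ * _)%g.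
Qed.

Let HV A : H A -> H (invmx A).
Proof.
move=> [g [<- [w [wS wg]]]].
exists g^-1%g; split=> //; exists (rev [seq s^-1%g | s <- w]); split.
  move=> s; rewrite mem_rev => /mapP[u uw ->].
  by have [us|us] := wS u uw; [right; rewrite /= invgK|left].
rewrite -wg /wprod; elim: (w) => [|u v IH] /=; first by rewrite !big_nil invg1.
by rewrite rev_cons -cats1 big_cat big_seq1 big_cons invgM IH.
Qed.

Let Hgen i b : H (affmx (tplus lam i) (cst lam b)).
Proof.
have h : in_Gamma (affmx (tplus lam i) (cst lam b)).
  exists (fun j => (j == i)%:Z), (cst lam b); congr affmx.
  rewrite /tmon (bigD1 i) //= eqxx expr1z big1 ?mulr1 // => j /negPf ->.
  by rewrite expr0z.
pose g : Gamma := MkGamma (asboolT h).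
exists g; split=> //; exists [:: g]; split; last by rewrite /wprod big_seq1.
by move=> s; rewrite inE => /eqP ->; left; left; exists i, b.
Qed.

Let Hdiag k : H (affmx (tmon k) 0).
Proof.
have Hn i n : H (affmx (tplus lam i ^+ n) 0).
  elim: n => [|n IH]; first by rewrite expr0 affmx1.
  have := HM (Hgen i 0) IH.
  by rewrite affmxM cst0 mulr0 addr0 -exprS.
rewrite /tmon; elim/big_rec: _ => [|i x _ IH]; first by rewrite affmx1.
suff h : H (affmx (tplus lam i ^ k i) 0).
  by have := HM h IH; rewrite affmxM mulr0 addr0.
case: (k i) => n; first exact: Hn.
have := HV (Hn i n.+1).
by rewrite affmxV ?unitrX ?tplus_unit // mulr0 oppr0.
Qed.

Let Huni (p : {poly L}) : H (affmx 1 (ofpoly lam p)).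
Proof.
have i0 : 'I_m := Ordinal m_gt0.
have HC b : H (affmx 1 (cst lam b)).
  have := HM (Hgen i0 b) (HV (Hgen i0 0)).
  rewrite affmxV ?tplus_unit // affmxM mulrV ?tplus_unit //.
  by rewrite cst0 mulr0 oppr0 mulr0 add0r.
have HD x y : H (affmx 1 x) -> H (affmx 1 y) -> H (affmx 1 (x + y)).
  by move=> hx hy; have := HM hy hx; rewrite affmxM !mul1r.
have HT x : H (affmx 1 x) -> H (affmx 1 (tplus lam i0 * x)).
  move=> hx; have := HM (HM (Hgen i0 0) hx) (HV (Hgen i0 0)).
  rewrite affmxV ?tplus_unit // !affmxM mulr1 mulrV ?tplus_unit //.
  by rewrite cst0 mulr0 oppr0 mulr0 add0r addr0.
suff h (c : L) : H (affmx 1 (ofpoly lam (c *: p))) by rewrite -[p]scale1r.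
elim/poly_ind: p c => [|p b IH] c.
  by rewrite scaler0 rmorph0 affmx1.
have -> : c *: (p * 'X + b%:P) =
    ('X + (lam i0)%:P) * (c *: p) + ((- (c * lam i0)) *: p + (c * b)%:P).
  by rewrite -!mul_polyC !rmorphN !rmorphM /=; ring.
have := HD _ _ (HT _ (IH c)) (HD _ _ (IH (- (c * lam i0))) (HC (c * b))).
rewrite tplusE /cst; congr (H (affmx 1 _)).
by rewrite [RHS]rmorphD (rmorphM (ofpoly lam)) (rmorphD (ofpoly lam) (_ *: _)).
Qed.

Lemma gamma_gens_generates (g : Gamma) :
  exists w, word_over gamma_gens w /\ wprod w = g.
Proof.
suff [h [hg]] : H (Gamma_mx g) by have -> : h = g by exact: val_inj.
have [k [P ->]] := GammaP g.
have [p [l ->]] := locpolyP P.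
pose u := tmon (fun i => (l i : int)).
have uu : u \is a GRing.unit := tmon_unit _.
have -> : ofpoly lam p / \prod_i tplus lam i ^+ l i = u^-1 * ofpoly lam p.
  by rewrite mulrC.
have := HM (HM (HM (HV (Hdiag (fun i => (l i : int)))) (Huni p))
  (Hdiag (fun i => (l i : int)))) (Hdiag k).
rewrite -/u affmxV // !affmxM mulr1 mulVr // mul1r !mulr0 oppr0 !add0r.
by rewrite addr0.
Qed.

Definition gamma_gen_set : fin_gen_set Gamma :=
  FinGenSet gamma_gens_finite gamma_gens_generates.

End Generation.
End Gamma.

Section Generators.
Variables (d : nat) (d_gt1 : (1 < d)%N).
Variables (L : finComUnitRingType) (lam : 'I_d.-1 -> L).

Let pred_d_gt0 : (0 < d.-1)%N. Proof. by rewrite ltn_predRL. Qed.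

(* The index set {1, ..., d - 1} is represented by 'I_d.-1. *)
Definition S_dq : fin_gen_set (Gamma lam) := gamma_gen_set lam pred_d_gt0.

End Generators.

(* Main.v *)
(* An element of Gamma is a d-tuple of vertices of trees, one for each pole
   - lam i and one for infinity, whose heights sum to 0; a generator moves one
   vertex up to its parent and another one down to a child. Let g have all
   heights 0 and a translation part whose vertex branches off from the base
   point exactly n levels up in each of the d trees. A path from 1 to g must
   climb n levels in every tree. Let alpha < beta be the first and last of d
   times at which the various trees are n levels up. By time beta there have
   been d n climbs and, in addition, as many climbs as there were descents
   before alpha, so that beta >= d n + alpha; as alpha >= n and at least n steps
   remain after beta, the length of g is at least (d + 2) n. Conversely, an
   element that branches off at most n levels up and has small heights is
   reached in at most (d + 2) n steps: climb n levels in a first tree while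
   descending in a last one, then climb the trees one after another, descending
   in those already climbed, each descent being used to correct one coefficient
   of the translation part. All elements close to g are of this kind. *)
Require Import Defs.
From HB Require Import structures.
From mathcomp Require Import all_boot all_order all_algebra.
From mathcomp Require Import boolp classical_sets.
From mathcomp Require Import ring zify.
Set Implicit Arguments.
Unset Strict Implicit.
Unset Printing Implicit Defensive.

Section HorocyclicProduct.
Import Order.TTheory GRing.Theory Num.Theory.
Local Open Scope ring_scope.

Variables (L : finComUnitRingType) (m : nat) (lam : 'I_m -> L).
Hypothesis lam_unit : forall i j, i != j -> lam i - lam j \is a GRing.unit.

Local Notation R := (locpoly lam).
Local Notation tree := (option 'I_m).
Local Notation of_poly := (ofpoly lam).
Local Notation cst := (cst lam).

(** * Exponent vectors on the set of trees and their denominators *)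

Definition single (V : nmodType) (a : tree) (x : V) : {ffun tree -> V} :=
  [ffun c => if c == a then x else 0].

Lemma singleD (V : nmodType) a (x y : V) :
  single a (x + y) = single a x + single a y.
Proof. by apply/ffunP => c; rewrite !ffunE; case: ifP; rewrite ?addr0. Qed.

(* [None] stands for the tree at infinity, [Some i] for the one at [- lam i]. *)
Definition lpoly (a : tree) : {poly L} :=
  if a is Some i then 'X + (lam i)%:P else 1.

Definition lfrac (a : tree) : R := of_poly (lpoly a).

Lemma lfrac_unit a : lfrac a \is a GRing.unit.
Proof.
case: a => [i|]; rewrite /lfrac /=; last by rewrite rmorph1 unitr1.
by rewrite -tplusE tplus_unit.
Qed.
Hint Resolve lfrac_unit : core.

Definition sden (e : {ffun tree -> nat}) : {poly L} := \prod_a lpoly a ^+ e a.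

Lemma sdenD e f : sden (e + f) = sden e * sden f.
Proof.
by rewrite /sden -big_split; apply: eq_bigr => a _; rewrite ffunE exprD.
Qed.

Lemma sden_single a n : sden (single a n) = lpoly a ^+ n.
Proof.
rewrite /sden (bigD1 a) //= ffunE eqxx big1 ?mulr1 // => c /negPf ca.
by rewrite ffunE ca.
Qed.

Lemma sden0 : sden 0 = 1.
Proof. by rewrite /sden big1 // => a _; rewrite ffunE expr0. Qed.

Lemma lpoly_monic a : lpoly a \is monic.
Proof. by case: a => [i|] /=; rewrite ?monic1 ?monicXaddC. Qed.

Lemma sden_monic e : sden e \is monic.
Proof. by apply: monic_prod => a _; rewrite monic_exp ?lpoly_monic. Qed.

Lemma sden_unit e : of_poly (sden e) \is a GRing.unit.
Proof.
rewrite rmorph_prod; apply/unitr_prodP => a _ _.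
by rewrite rmorphXn unitrX ?lfrac_unit.
Qed.

Definition wt (e : {ffun tree -> nat}) : nat := (\sum_a e a)%N.

Lemma wtD e f : wt (e + f) = (wt e + wt f)%N.
Proof. by rewrite /wt -big_split; apply: eq_bigr => a _; rewrite ffunE. Qed.

Lemma wt_single a n : wt (single a n) = n.
Proof.
rewrite /wt (bigD1 a) //= ffunE eqxx big1 ?addn0 // => c /negPf ca.
by rewrite ffunE ca.
Qed.

(** The factor at infinity is [1]: its exponent counts in [wt e] but not in the degree. *)
Lemma size_sden e : (size (sden e) + e None = (wt e).+1)%N.
Proof.
have -> : size (sden e) = (\sum_(a : tree | a != None) e a).+1.
  rewrite /sden (bigD1 None) //= expr1n mul1r.
  elim/big_rec2: _ => [|a s p aN IH]; first by rewrite size_poly1.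
  suff -> : size (lpoly a ^+ e a * p) = (e a + size p)%N.
    by rewrite IH addnS.
  elim: (e a) => [|k IHk]; first by rewrite expr0 mul1r.
  have p0 : lpoly a ^+ k * p != 0.
    by rewrite -size_poly_gt0 IHk IH addnS.
  rewrite exprS -mulrA size_monicM ?lpoly_monic // IHk.
  by case: a aN {IHk p0} => // i _; rewrite size_XaddC.
by rewrite /wt [in RHS](bigD1 None) //= addSn addnC.
Qed.

Lemma size_sden_le e : (size (sden e) <= (wt e).+1)%N.
Proof. by rewrite -size_sden leq_addr. Qed.

(** * Fractions with bounded poles *)

(* [V e] is the set of fractions with a pole of order at most [e (Some i)] at
   [- lam i] and of degree less than [e None]. *)
Definition V (e : {ffun tree -> nat}) (D : R) : Prop :=
  exists2 Q : {poly L}, (size Q <= wt e)%N & D * of_poly (sden e) = of_poly Q.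

Lemma V_add e D E : V e D -> V e E -> V e (D + E).
Proof.
move=> [P sP eP] [Q sQ eQ].
exists (P + Q); last by rewrite mulrDl eP eQ rmorphD.
by rewrite (leq_trans (size_polyD _ _)) // geq_max sP.
Qed.

Lemma V_zero D : V 0 D -> D = 0.
Proof.
move=> [Q]; rewrite sden0 rmorph1 mulr1 => sQ ->.
suff -> : Q = 0 by rewrite rmorph0.
apply/eqP; rewrite -size_poly_leq0 (leq_trans sQ) //.
by rewrite /wt big1 // => a _; rewrite ffunE.
Qed.

Lemma V0 e : V e 0.
Proof. by exists 0; rewrite ?size_poly0 ?mul0r ?rmorph0. Qed.

Lemma V_mul e u v D :
  V (e + single u 1%N) D -> V (e + single v 1%N) (lfrac u / lfrac v * D).
Proof.
move=> [Q sQ]; rewrite sdenD sden_single expr1 rmorphM /= => eQ.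
exists Q; first by move: sQ; rewrite !wtD !wt_single.
rewrite sdenD sden_single expr1 -eQ rmorphM /= -!/(lfrac _).
rewrite [LHS](_ : _ = D * (of_poly (sden e) * lfrac u) *
  (lfrac v * (lfrac v)^-1)); first by rewrite divrr ?mulr1.
by ring.
Qed.

Lemma V_cst e u b : V (e + single u 1%N) (cst b / lfrac u).
Proof.
exists (b%:P * sden e).
  rewrite mul_polyC (leq_trans (size_scale_leq _ _)) //.
  by rewrite wtD wt_single addn1 size_sden_le.
rewrite sdenD sden_single expr1 rmorphM /= -/(lfrac u) rmorphM /=.
rewrite [LHS](_ : _ = cst b * of_poly (sden e) * (lfrac u * (lfrac u)^-1)).
  by rewrite divrr ?mulr1.
by ring.
Qed.

(** The invertible differences of the [lam i] enter here. *)
Lemma lpoly_eval i a : a != Some i -> (lpoly a).[- lam i] \is a GRing.unit.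
Proof.
case: a => [j|_] /=; last by rewrite hornerE unitr1.
by move=> ji; rewrite !hornerE addrC lam_unit //; apply: contra ji => /eqP ->.
Qed.

Lemma sden_eval i (e : {ffun tree -> nat}) : e (Some i) = 0%N ->
  (sden e).[- lam i] \is a GRing.unit.
Proof.
move=> ei; rewrite horner_prod; apply/unitr_prodP => a _ _; rewrite horner_exp.
have [->|ai] := eqVneq a (Some i); first by rewrite ei expr0 unitr1.
by rewrite unitrX ?lpoly_eval.
Qed.

(* When [D] is regular at the tree [v], [b] can be chosen to cancel its value
   there (its leading coefficient if [v] is infinity), so that the division by
   [lfrac v] creates no pole. *)
Lemma V_step (e : {ffun tree -> nat}) u v D :
  e v = 0%N -> V (e + single u 1%N) D ->
  exists b, V e ((lfrac u * D - cst b) / lfrac v).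
Proof.
move=> ev [Q sQ eQ].
suff [b [Q' [sQ' eQ']]] : exists (b : L) (Q' : {poly L}),
    (size Q' <= wt e)%N /\ Q - b *: sden e = Q' * lpoly v.
  exists b, Q' => //; move/(congr1 of_poly): eQ'.
  rewrite -mul_polyC rmorphB !rmorphM /= -eQ sdenD sden_single expr1.
  rewrite !rmorphM /=.
  rewrite -/(lfrac u) -/(lfrac v) -/(cst b) => eQ'.
  apply: (mulIr (lfrac_unit v)); rewrite -eQ'.
  rewrite mulrAC divrK //; ring.
move: sQ; rewrite wtD wt_single addn1 => sQ.
have sB (b : L) : (size (Q - b *: sden e)%R <= (wt e).+1)%N.
  rewrite (leq_trans (size_polyD _ _)) // geq_max sQ size_polyN.
  by rewrite (leq_trans (size_scale_leq _ _)) // size_sden_le.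
case: v ev => [i|] ev.
  (* This ratio makes the new numerator vanish at [- lam i], so [lpoly v] divides it. *)
  set b := Q.[- lam i] / (sden e).[- lam i].
  have /factor_theorem [Q' eQ'] : root (Q - b *: sden e) (- lam i).
    by rewrite rootE !hornerE divrK ?sden_eval // subrr.
  exists b, Q'; split; last by rewrite eQ' polyCN opprK.
  have [->|Q0] := eqVneq Q' 0; first by rewrite size_poly0.
  by have := sB b; rewrite eQ' size_Mmonic ?monicXsubC // size_XsubC addn2.
(* At infinity [lpoly v] is [1]. As [e None = 0], [sden e] is monic of degree [wt e], and
   subtracting a multiple removes the top coefficient. *)
exists Q`_(wt e), (Q - Q`_(wt e) *: sden e); split; last by rewrite mulr1.
apply/leq_sizeP => j; rewrite leq_eqVlt => /predU1P[<-|lt].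
  have /monicP := sden_monic e; rewrite /lead_coef.
  have := size_sden e; rewrite ev addn0 => -> /= h.
  by rewrite coefB coefZ h mulr1 subrr.
by have /leq_sizeP := sB Q`_(wt e); apply.
Qed.

(** * Paths and the group elements they spell *)

(* The step [(u, v, b)] moves up in the tree [u] and down in the tree [v]; it
   is the generator [stepmx u v b] below. *)
Local Notation step := (tree * tree * L)%type.

(** Upper right entry of the product of the step matrices; [slope] is the upper left one. *)
Fixpoint disp (w : seq step) : R :=
  if w is (u, v, b) :: w' then lfrac v / lfrac u * disp w' + cst b / lfrac u
  else 0.

Definition ups (a : tree) (w : seq step) := count (fun s => s.1.1 == a) w.
Definition downs (a : tree) (w : seq step) := count (fun s => s.1.2 == a) w.
Definition valid (w : seq step) := all (fun s => s.1.1 != s.1.2) w.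

(** By induction: a first step [(u, v, b)] uses up one level of [u] and grants the rest of the path
    one more level of [v]. *)
Lemma disp_V w (e : {ffun tree -> nat}) : valid w ->
  (forall r a, ups a (take r w) <= e a + downs a (take r w))%N -> V e (disp w).
Proof.
elim: w e => [|[[u v] b] w IH] e /=; first by move=> _ _; exact: V0.
move=> /andP[/= uv vw] H.
have eu : (0 < e u)%N.
  have := H 1%N u; rewrite /= take0 /ups /downs /= eqxx eq_sym (negPf uv).
  by rewrite !addn0.
pose e0 : {ffun tree -> nat} := [ffun a => e a - (a == u)]%N.
have -> : e = e0 + single u 1%N.
  apply/ffunP => a; rewrite !ffunE.
  have [->|] := eqVneq a u; last by rewrite subn0 addr0.
  by rewrite -[RHS]/(_ + _)%N subnK.
apply: V_add; last exact: V_cst.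
apply: V_mul; apply: IH => // r a.
have := H r.+1 a; rewrite /ups /downs /= !ffunE -/(ups _ _) -/(downs _ _).
rewrite (eq_sym u a) (eq_sym v a).
rewrite -[(_ + _)%R]/(_ + _)%N.
have [-> |_] := eqVneq a u; have [?|_] := eqVneq _ v; lia.
Qed.

Definition slope (w : seq step) : R :=
  \prod_(s <- w) (lfrac s.1.2 / lfrac s.1.1).

Lemma tmon_single v : tmon lam (fun i => (v == Some i)%:Z) = lfrac v.
Proof.
rewrite /tmon; case: v => [i|] /=; last first.
  by rewrite big1 /lfrac ?rmorph1 // => i _; rewrite expr0z.
rewrite (bigD1 i) //= eqxx expr1z big1 ?mulr1 ?/lfrac ?tplusE // => j ji.
by rewrite (inj_eq Some_inj) eq_sym (negPf ji) expr0z.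
Qed.

Lemma slope_tmon w :
  slope w = tmon lam (fun i => (downs (Some i) w)%:Z - (ups (Some i) w)%:Z).
Proof.
elim: w => [|[[u v] b] w IH]; first by rewrite /slope big_nil -(tmon0 lam).
rewrite /slope big_cons -/(slope w) IH -!tmon_single -tmonN -!tmonD.
by apply: eq_bigr => i _ /=; congr (_ ^ _); rewrite !PoszD; ring.
Qed.


(** * Upper bound: construction of short paths *)

(* [r] lists the heights of the end point in all the trees; the entry at [None]
   is minus the sum of the others. *)
Definition reach (T : nat) (r : {ffun tree -> int}) (D : R) : Prop :=
  exists w, [/\ size w = T, valid w, disp w = D &
    forall a, r a = (downs a w)%:Z - (ups a w)%:Z].

Lemma shiftE (r : {ffun tree -> int}) u v (x y : int) a :
  (r + single u x - single v y) a =
    r a + (if a == u then x else 0) - (if a == v then y else 0).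
Proof. by rewrite !ffunE. Qed.

Lemma sum_shift (r : {ffun tree -> int}) u v (x : int) :
  \sum_a (r + single u x - single v x) a = \sum_a r a.
Proof.
have sumS b : \sum_i (if i == b then x else 0) = x.
  by rewrite -big_mkcond big_pred1_eq.
under eq_bigr do rewrite shiftE.
by rewrite !big_split /= sumrN !sumS addrK.
Qed.

Lemma reach_cons T (r : {ffun tree -> int}) D u v b : u != v ->
  reach T (r + single u 1 - single v 1) ((lfrac u * D - cst b) / lfrac v) ->
  reach T.+1 r D.
Proof.
move=> uv [w [sw vw dw hw]]; exists ((u, v, b) :: w); split=> /=.
- by rewrite sw.
- by rewrite uv.
- rewrite dw.
  rewrite [LHS](_ : _ = lfrac v / lfrac v * (lfrac u / lfrac u) * D +
    (1 - lfrac v / lfrac v) * cst b / lfrac u); last by ring.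
  by rewrite !divrr // subrr !mul1r !mul0r addr0.
- move=> a; have := hw a.
  rewrite !shiftE /downs /ups /= !PoszD (eq_sym u) (eq_sym v).
  by do 2 case: ifP => _ /=; lia.
Qed.

(** Each step up in [u] and down in [v] takes its [b] from [V_step], so that no pole arises at
    [v]. *)
Lemma reach_settle n (e : {ffun tree -> nat}) u v (r : {ffun tree -> int}) T D :
  u != v -> e v = 0%N -> V (e + single u n) D ->
  (forall D', V e D' -> reach T (r + single u n%:Z - single v n%:Z) D') ->
  reach (n + T) r D.
Proof.
move=> uv ev; elim: n r D => [|n IH] r D.
  have -> : single u 0%N = 0 by apply/ffunP => a; rewrite !ffunE; case: ifP.
  rewrite addr0 => VD /(_ D VD); rewrite add0n; congr reach.
  apply/ffunP => a; rewrite !shiftE.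
  by move: (r a) => x; do 2 case: ifP => _; lia.
rewrite -addn1 singleD addrA => VD H.
have [|b Vb] := V_step (v := v) _ VD.
  by rewrite !ffunE ev eq_sym (negPf uv).
rewrite addnAC addn1; apply: (reach_cons uv (b := b)).
apply: IH Vb _ => D' /H; congr reach.
apply/ffunP => a; rewrite !shiftE.
by move: (r a) => x; do 2 case: ifP => _; lia.
Qed.

(** All steps carry the coefficient [0]: the allowed pole order is moved from [u] to [v], to be
    dealt with later. *)
Lemma reach_defer n (e : {ffun tree -> nat}) u v (r : {ffun tree -> int}) T D :
  u != v -> V (e + single u n) D ->
  (forall D', V (e + single v n) D' ->
    reach T (r + single u n%:Z - single v n%:Z) D') ->
  reach (n + T) r D.
Proof.
move=> uv; elim: n e r D => [|n IH] e r D.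
  have s0 c : single c 0%N = 0 by apply/ffunP => a; rewrite !ffunE; case: ifP.
  rewrite !s0 => VD /(_ D VD); rewrite add0n; congr reach.
  apply/ffunP => a; rewrite !shiftE.
  by move: (r a) => x; do 2 case: ifP => _; lia.
rewrite -addn1 !singleD !addrA => /(V_mul v) VD H.
rewrite addnAC addn1; apply: (reach_cons uv (b := 0)).
rewrite cst0 subr0 mulrAC.
rewrite addrAC in VD; apply: IH VD _ => D'; rewrite addrAC => /H; congr reach.
apply/ffunP => a; rewrite !shiftE.
by move: (r a) => x; do 2 case: ifP => _; lia.
Qed.

Lemma reach_diag (T : nat) a (r : {ffun tree -> int}) :
  \sum_c r c = 0 -> r a = T%:Z -> (forall c, c != a -> r c <= 0) -> reach T r 0.
Proof.
elim: T r => [|T IH] r sr ra rc.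
  exists [::]; split=> // c; have [->|ca] := eqVneq c a; first by rewrite ra.
  move: sr; rewrite (bigD1 a) //= ra add0r => /eqP; rewrite -oppr_eq0 -sumrN.
  move/eqP/psumr_eq0P => h; apply/eqP; rewrite -oppr_eq0 h // => i ia.
  by rewrite oppr_ge0 rc.
(* The heights sum to 0 and [r a] is positive, so another tree must still be climbed. *)
have /existsP[c /andP[ca rc0]] : [exists c, (c != a) && (r c < 0)].
  apply: contraT; rewrite negb_exists => /forallP h.
  suff : 0 < \sum_c r c by rewrite sr.
  rewrite (bigD1 a) //= ltr_wpDr ?ra // sumr_ge0 // => c ca.
  by have := h c; rewrite negb_and ca /= -leNgt.
apply: (reach_cons ca (b := 0)); rewrite cst0 mulr0 subrr mul0r.
apply: IH; first by rewrite sum_shift sr.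
  by rewrite shiftE ra eqxx eq_sym (negPf ca); lia.
move=> b ba; rewrite shiftE (negPf ba); have := rc b ba.
case: eqP => [->|_]; first by lia.
by move: (r b) => x; lia.
Qed.

(** Only [a] still has poles. The [c] climbs in it leave room for all pending descents in the other
    trees; then [c + r a] descents in [a] finish by [reach_diag]. *)
Lemma reach_final c T a (r : {ffun tree -> int}) D :
  (0 < m)%N -> V (single a c) D -> \sum_b r b = 0 ->
  T%:Z = c%:Z + c%:Z + r a -> 0 <= r a + c%:Z ->
  \sum_(b | b != a) Num.max (r b) 0 <= c%:Z -> reach T r D.
Proof.
move=> m_gt0; elim: c T r D => [|c IH] T r D.
  have -> : single a 0%N = 0 by apply/ffunP => b; rewrite !ffunE; case: ifP.
  move=> /V_zero -> sr; rewrite !add0r => /esym ra _ le.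
  apply: reach_diag ra _ => // b ba.
  move: le; rewrite (bigD1 b) //= => le.
  have : 0 <= \sum_(i | (i != a) && (i != b)) Num.max (r i) 0.
    by apply: sumr_ge0 => i _; rewrite le_max lexx orbT.
  by move: (r b) (\sum_(i | _) _) le => x y; lia.
move=> VD sr eT ra le.
have [b ba brb] : exists2 b, b != a &
    \sum_(i | i != a) Num.max (r i) 0 > 0 -> 0 < r b.
  have [b0 b0a] : exists b0, b0 != a.
    by case: (a) => [i|]; [exists None|exists (Some (Ordinal m_gt0))].
  have [/existsP[b /andP[ba rb]]|] := boolP [exists b, (b != a) && (0 < r b)].
    by exists b.
  rewrite negb_exists => /forallP h; exists b0 => //.
  rewrite big1 // => i ia; apply/max_idPr.
  by have := h i; rewrite ia /= -leNgt.
rewrite -addn1 singleD in VD.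
have [|b' Vb] := V_step (v := b) _ VD; first by rewrite ffunE (negPf ba).
have [T' eT'] : exists T' : nat, T = T'.+1.
  by exists T.-1; move: (r a) eT ra => x; lia.
rewrite eT'; rewrite eq_sym in ba; apply: (reach_cons ba (b := b')).
apply: IH Vb _ _ _ _; first by rewrite sum_shift.
- by rewrite shiftE eqxx (negPf ba); move: (r a) eT ra => x; lia.
- by rewrite shiftE eqxx (negPf ba); move: (r a) eT ra => x; lia.
rewrite eq_sym in ba.
have -> : \sum_(i | i != a) Num.max ((r + single a 1 - single b 1) i) 0 =
    Num.max (r b - 1) 0 + \sum_(i | (i != a) && (i != b)) Num.max (r i) 0.
  rewrite (bigD1 b) //= shiftE eqxx (negPf ba) addr0; congr (_ + _).
  apply: eq_bigr => i /andP[ia ib].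
  by rewrite shiftE (negPf ia) (negPf ib) addr0 subr0.
move: le brb; rewrite (bigD1 b) //=.
have : 0 <= \sum_(i | (i != a) && (i != b)) Num.max (r i) 0.
  by apply: sumr_ge0 => i _; rewrite le_max lexx orbT.
move: (r b) (\sum_(i | _) _) => x y; lia.
Qed.

(** The tree [p] has no pole left, so descents in it can carry the corrections while the next tree
    is climbed, which then plays the part of [p]. The height changes telescope. *)
Lemma reach_chain n a l p (r : {ffun tree -> int}) T D :
  uniq (a :: p :: l) ->
  V (single a (n + n)%N + \sum_(c <- l) single c n) D ->
  (forall D', V (single a (n + n)%N) D' ->
    reach T (r + single (last p l) n%:Z - single p n%:Z) D') ->
  reach (size l * n + T) r D.
Proof.
elim: l p r D => [|c l IH] p r D /=.
  rewrite big_nil addr0 => _ VD /(_ D VD); rewrite mul0n add0n; congr reach.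
  by apply/ffunP => b; rewrite !shiftE; move: (r b) => x; case: ifP => _; lia.
rewrite !inE !negb_or -!andbA => /and5P[ap ac al pc /and3P[pl cl ul]].
rewrite big_cons addrCA addrC => VD H; rewrite mulSn -addnA.
apply: (reach_settle (u := c) (v := p)) VD _; first by rewrite eq_sym.
  rewrite ffunE ffunE eq_sym (negPf ap) add0r sum_ffunE big1_seq // => b /= bl.
  by rewrite ffunE; case: eqP bl => // <-; rewrite (negPf pl).
move=> D' VD'; apply: (IH c) VD' _ => /=.
  by rewrite !inE negb_or ac al cl.
move=> D'' /H; congr reach; apply/ffunP => b; rewrite !shiftE.
by move: (r b) => x; do 3 case: ifP => _; lia.
Qed.

(** The trees are climbed in the order [p], [l], [a]. The climb in [p] descends in [a] and so
    doubles the pole order allowed at [a]. *)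
Lemma reach_ball n N (r : {ffun tree -> int}) D :
  (0 < m)%N -> (m * N <= n)%N -> (N <= n)%N -> V [ffun=> n] D ->
  \sum_a r a = 0 -> (forall a, `|r a| <= N%:Z) ->
  exists2 T, (T <= m.+3 * n)%N & reach T r D.
Proof.
move=> m_gt0 mN Nn VD sr rN.
(* Choosing the last tree with [r a <= 0] keeps the total within [m.+3 * n]. *)
have /existsP[a ra] : [exists a, r a <= 0].
  apply: contraT; rewrite negb_exists => /forallP h.
  suff : 0 < \sum_c r c by rewrite sr.
  rewrite (bigD1 None) //= ltr_wpDr //.
    by apply: sumr_ge0 => c _; have := h c; rewrite -ltNge => /ltW.
  by rewrite ltNge h.
have [p pa] : exists p, p != a.
  by case: (a) => [i|]; [exists None|exists (Some (Ordinal m_gt0))].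
pose l := [seq c <- index_enum tree | (c != a) && (c != p)].
have ul : uniq [:: a, p & l].
  rewrite /= !inE !mem_filter !eqxx (eq_sym a) (negPf pa) /=.
  by rewrite filter_uniq // index_enum_uniq.
have pl : perm_eq [:: a, p & l] (index_enum tree).
  apply: uniq_perm => //; first exact: index_enum_uniq.
  move=> c; rewrite mem_index_enum !inE mem_filter mem_index_enum.
  by case: (c == a); case: (c == p).
have sl : (size l).+2 = m.+1.
  rewrite -[LHS]/(size [:: a, p & l]) (perm_size pl) -[index_enum _]enumT.
  by rewrite -cardE card_option card_ord.
have E : [ffun=> n] = single a n + \sum_(c <- l) single c n + single p n.
  apply/ffunP => b; rewrite ffunE.
  have -> : single a n + \sum_(c <- l) single c n + single p n =
      \sum_c single c n.
    by rewrite -(perm_big _ pl) /= !big_cons addrA addrAC.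
  rewrite sum_ffunE (bigD1 b) //= ffunE eqxx big1 ?addr0 // => i ib.
  by rewrite ffunE eq_sym (negPf ib).
rewrite E in VD.
(* There are [2n] climbs in [a] and as many descents, adjusted by the pending height [r a - n]. *)
pose T := absz (n%:Z + n%:Z + n%:Z + r a).
have eT : T%:Z = n%:Z + n%:Z + n%:Z + r a.
  by rewrite gez0_abs //; have := rN a; move: (r a) => x; lia.
exists (n + (size l * n + T))%N.
  by rewrite -sl; move: (r a) ra eT => x; nia.
apply: (reach_defer (v := a)) VD _ => // D' VD'.
have qa : last p l != a.
  move: ul => /= /andP[h _].
  by apply: contraNneq h => <-; exact: mem_last.
apply: (reach_chain (p := p) ul); first by rewrite singleD addrAC.
move=> D'' VD''; apply: (reach_final m_gt0 VD'').
- by rewrite !sum_shift.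
- rewrite !shiftE !eqxx [a == p]eq_sym (negPf pa) eq_sym (negPf qa).
  by move: (r a) eT => x; lia.
- rewrite !shiftE !eqxx [a == p]eq_sym (negPf pa) eq_sym (negPf qa).
  by have := rN a; move: (r a) => x; lia.
set r' := (_ - _).
(* The [m] other trees owe at most [N] descents each, and the last one climbed [n] more: at most
   [2n] in all, since [m * N <= n]. *)
have le b : b != a ->
    Num.max (r' b) 0 <= N%:Z + (if b == last p l then n%:Z else 0).
  move=> ba; have := rN b; rewrite !shiftE (negPf ba); move: (r b) => x.
  by do 2 case: ifP => _; lia.
apply: (le_trans (ler_sum _ le)).
rewrite big_split /= sumr_const.
have -> : \sum_(i | i != a) (if i == last p l then n%:Z else 0) = n%:Z.
  rewrite -big_mkcondr (big_pred1 (last p l)) // => i.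
  by rewrite /= andbC; case: eqP => [->|]; rewrite ?qa.
have -> : #|[pred i | i != a]| = m.
  by rewrite cardC1 card_option card_ord.
by move: mN; rewrite -mulr_natr natz; nia.
Qed.


(** * Lower bound: deep fractions need long paths *)

(** Otherwise, cancelling common factors and evaluating at [- lam i] would make a unit equal to
    0. *)
Lemma sden_pole (Q Q' : {poly L}) (e f : {ffun tree -> nat}) i :
  Q * sden e = Q' * sden f -> Q.[- lam i] \is a GRing.unit ->
  (f (Some i) <= e (Some i))%N.
Proof.
move=> QQ' uQ; case: leqP => // lt.
pose e0 : {ffun tree -> nat} := [ffun a => if a == Some i then 0%N else e a].
pose f0 : {ffun tree -> nat} :=
  [ffun a => if a == Some i then (f a - e a).-1 else f a].
have Ee : e = e0 + single (Some i) (e (Some i)).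
  apply/ffunP => a; rewrite !ffunE.
  by case: eqP => [->|_]; rewrite ?add0r ?addr0.
have Ef : f = f0 + single (Some i) 1%N + single (Some i) (e (Some i)).
  apply/ffunP => a; rewrite !ffunE.
  case: eqP => [->|_]; rewrite ?addr0 //.
  by rewrite -[RHS]/(_ + _ + _)%N; move: (f _) (e _) lt => x y; lia.
move: QQ'; rewrite Ee Ef !sdenD !mulrA.
move/(monic_rreg (sden_monic _))/(congr1 (horner^~ (- lam i))).
rewrite !hornerM sden_single expr1 /=.
rewrite hornerD hornerX hornerC addNr mulr0 => h.
have : Q.[- lam i] * (sden e0).[- lam i] \is a GRing.unit.
  by rewrite unitrM uQ sden_eval // ffunE eqxx.
by rewrite h unitr0.
Qed.

(** The numerator [Q] is 1 at every [- lam i] and has the largest size allowed, so the finite poles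
    have order exactly [n] and the degree is [n - 1]. *)
Lemma deep_fraction n : (0 < m)%N -> (0 < n)%N ->
  exists2 D, V [ffun=> n] D & forall e, V e D -> forall a, (n <= e a)%N.
Proof.
move=> m_gt0 n_gt0.
pose e1 : {ffun tree -> nat} := [ffun a => (a != None : nat)].
pose k := (m.+1 * n - m.+1)%N.
pose Q := sden e1 * 'X^k + 1.
have wtn : wt [ffun=> n] = (m.+1 * n)%N.
  rewrite /wt; under eq_bigr do rewrite ffunE.
  by rewrite sum_nat_const card_option card_ord.
have sQ : size Q = (m.+1 * n)%N.
  have s1 : size (sden e1) = m.+1.
    have := size_sden e1; rewrite ffunE /= addn0 => ->; congr _.+1.
    rewrite /wt (bigD1 None) //= ffunE /= add0n.
    under eq_bigr => a aN do rewrite ffunE aN.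
    by rewrite sum1_card cardC1 card_option card_ord.
  have s2 : size (sden e1 * 'X^k) = (m.+1 * n)%N.
    rewrite size_Mmonic ?monicXn //; last first.
      by rewrite monic_neq0 // sden_monic.
    by rewrite size_polyXn s1 /k; nia.
  by rewrite size_polyDl s2 // size_poly1; nia.
have Q1 i : Q.[- lam i] = 1.
  have -> : Q = sden [ffun a => (a != None) && (a != Some i) : nat] * 'X^k *
      lpoly (Some i) + 1.
    rewrite /Q; congr (_ + _); rewrite mulrAC; congr (_ * _).
    rewrite -[lpoly _]expr1 -sden_single -sdenD; congr sden.
    by apply/ffunP => -[j|]; rewrite !ffunE //=; case: eqP.
  by rewrite /= !hornerE addNr mulr0 add0r.
exists (of_poly Q / of_poly (sden [ffun=> n])).
  by exists Q; rewrite ?wtn ?sQ // divrK ?sden_unit.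
move=> e [Q' sQ' /(congr1 ( *%R^~ (of_poly (sden [ffun=> n])))) ].
rewrite mulrAC divrK ?sden_unit // -!rmorphM => /ofpoly_inj QQ' [i|].
  by have := sden_pole QQ'; move=> /(_ i); rewrite Q1 unitr1 ffunE; apply.
have Q0 : Q != 0 by rewrite -size_poly_gt0 sQ; nia.
(* At infinity degrees are compared; the size of [Q * sden e] is exact because [sden e] is monic. *)
have := size_polyMleq Q' (sden [ffun=> n]).
rewrite -QQ' size_Mmonic ?sden_monic // sQ.
have := size_sden e; have := size_sden [ffun=> n]; rewrite wtn ffunE.
move: sQ'; lia.
Qed.

Lemma slope_sden w : slope w * of_poly (sden [ffun a => ups a w]) =
  of_poly (sden [ffun a => downs a w]).
Proof.
elim: w => [|[[u v] b] w IH].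
  rewrite /slope big_nil mul1r.
  by congr (of_poly (sden _)); apply/ffunP => a; rewrite !ffunE.
rewrite /slope big_cons -/(slope w) /=.
have -> : [ffun a => ups a ((u, v, b) :: w)] =
    single u 1%N + [ffun a => ups a w].
  by apply/ffunP => a; rewrite !ffunE /ups /= eq_sym; case: eqP.
have -> : [ffun a => downs a ((u, v, b) :: w)] =
    single v 1%N + [ffun a => downs a w].
  by apply/ffunP => a; rewrite !ffunE /downs /= eq_sym; case: eqP.
rewrite !sdenD !sden_single !expr1 !rmorphM /= -IH -/(lfrac u) -/(lfrac v).
rewrite [LHS](_ : _ = lfrac u / lfrac u *
  (lfrac v * (slope w * of_poly (sden [ffun a => ups a w])))).
  by rewrite divrr ?mul1r.
by ring.
Qed.

Lemma sum_ups w : (\sum_a ups a w)%N = size w.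
Proof.
elim: w => [|s w IH]; first by rewrite big1.
rewrite /ups /= big_split /= -/(ups _ _) IH -add1n; congr addn.
by rewrite (bigD1 s.1.1) //= eqxx big1 // => a; rewrite eq_sym => /negPf ->.
Qed.

Lemma sum_downs w : (\sum_a downs a w)%N = size w.
Proof.
elim: w => [|s w IH]; first by rewrite big1.
rewrite /downs /= big_split /= -/(downs _ _) IH -add1n; congr addn.
by rewrite (bigD1 s.1.2) //= eqxx big1 // => a; rewrite eq_sym => /negPf ->.
Qed.

(** Finite trees follow from [sden_pole] used both ways, infinity from the equal totals of climbs
    and descents. *)
Lemma slope1_balanced w a : slope w = 1 -> downs a w = ups a w.
Proof.
move=> s1; have := slope_sden w; rewrite s1 mul1r => /ofpoly_inj e.
have H i : downs (Some i) w = ups (Some i) w.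
  have h := @sden_pole 1 1 _ _ i; rewrite hornerC unitr1 in h.
  apply/eqP; rewrite eqn_leq; apply/andP; split.
    by have := h _ _ (congr1 ( *%R 1) e) isT; rewrite !ffunE.
  by have := h _ _ (congr1 ( *%R 1) (esym e)) isT; rewrite !ffunE.
case: a => [i|]; first exact: H.
have := sum_ups w.
rewrite -(sum_downs w) (bigD1 None) //= [in RHS](bigD1 None) //=.
rewrite (eq_bigr (downs^~ w)); first by move/addIn.
by case=> // i _; rewrite H.
Qed.

Lemma ups_size a w : (ups a w <= size w)%N.
Proof. exact: count_size. Qed.

Lemma downs_size a w : (downs a w <= size w)%N.
Proof. exact: count_size. Qed.

Lemma ups_take_drop r a w : ups a w = (ups a (take r w) + ups a (drop r w))%N.
Proof. by rewrite /ups -count_cat cat_take_drop. Qed.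

Lemma downs_take_drop r a w :
  downs a w = (downs a (take r w) + downs a (drop r w))%N.
Proof. by rewrite /downs -count_cat cat_take_drop. Qed.

Lemma ups_take_le r r' a w : (r <= r')%N ->
  (ups a (take r w) <= ups a (take r' w))%N.
Proof.
by move=> le; rewrite (ups_take_drop r a (take r' w)) take_takel // leq_addr.
Qed.

Lemma downs_take_le r r' a w : (r <= r')%N ->
  (downs a (take r w) <= downs a (take r' w))%N.
Proof.
by move=> le; rewrite (downs_take_drop r a (take r' w)) take_takel // leq_addr.
Qed.

Lemma deep_size n w : valid w -> slope w = 1 -> (0 < n)%N ->
  (forall e, V e (disp w) -> forall a, (n <= e a)%N) -> (m.+3 * n <= size w)%N.
Proof.
move=> vw s1 n_gt0 deep.
pose hit a (r : 'I_(size w).+1) :=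
  (downs a (take r w) + n <= ups a (take r w))%N.
have ex_hit a : exists r, hit a r.
  apply/existsP; apply: contraT; rewrite negb_exists => /forallP h.
  (* If [a] were never [n] levels up, [disp_V] would apply with [n - 1] at [a], against [deep]. *)
  pose e : {ffun tree -> nat} := [ffun b => if b == a then n.-1 else size w].
  suff /deep/(_ a) : V e (disp w) by rewrite ffunE eqxx; lia.
  apply: disp_V => // r b; rewrite ffunE; case: eqP => [->|_]; last first.
    rewrite (leq_trans (ups_size _ _)) // size_take_min.
    by rewrite (leq_trans (geq_minr _ _)) ?leq_addr.
  wlog rw : r / (r <= size w)%N.
    move=> H; have [/H //|lt] := leqP r (size w).
    by have := H (size w) (leqnn _); rewrite !take_oversize // ltnW.
  by have := h (Ordinal (rw : (r < (size w).+1)%N)); rewrite /hit /=; lia.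
pose tau a := xchoose (ex_hit a).
have tauP a : hit a (tau a) := xchooseP (ex_hit a).
have sz a : size (take (tau a) w) = tau a.
  by rewrite size_takel // -ltnS.
have [a0 _ min0] := arg_minnP (P := xpredT) (i0 := None)
  (fun a => nat_of_ord (tau a)) isT.
have [a1 _ max1] := arg_maxnP (P := xpredT) (i0 := None)
  (fun a => nat_of_ord (tau a)) isT.
have le0 : (n <= tau a0)%N.
  have := tauP a0; rewrite /hit.
  by have := ups_size a0 (take (tau a0) w); rewrite sz; lia.
(* The path ends at height 0 in [a1], so the [n] levels gained there are still to be descended. *)
have le1 : (tau a1 + n <= size w)%N.
  have := tauP a1; rewrite /hit.
  have := slope1_balanced a1 s1.
  rewrite (downs_take_drop (tau a1)) (ups_take_drop (tau a1)).
  have := downs_size a1 (drop (tau a1) w); rewrite size_drop.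
  by have := ltn_ord (tau a1); lia.
(* In each tree the climbs before [tau a1] number at least [n] plus the descents before [tau a0];
   sum over the trees. *)
have le2 : (m.+1 * n + tau a0 <= tau a1)%N.
  have eU : (\sum_a ups a (take (tau a1) w))%N = tau a1 by rewrite sum_ups sz.
  have eD : (\sum_a downs a (take (tau a0) w))%N = tau a0.
    by rewrite sum_downs sz.
  rewrite -eD -eU.
  have -> : (m.+1 * n = \sum_(a : tree) n)%N.
    by rewrite sum_nat_const card_option card_ord.
  rewrite -big_split /=; apply: leq_sum => a _.
  have := tauP a; rewrite /hit.
  have := downs_take_le a w (min0 a isT).
  have := ups_take_le a w (max1 a isT).
  lia.
lia.
Qed.


(** * Generators as steps, and the dead end elements *)

Lemma slope_cons u v b w : slope ((u, v, b) :: w) = lfrac v / lfrac u * slope w.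
Proof. by rewrite /slope big_cons. Qed.

Definition stepmx (u v : tree) (b : L) : 'M[R]_2 :=
  affmx (lfrac v / lfrac u) (cst b / lfrac u).

Lemma stepmx_inv u v b : invmx (stepmx u v b) = stepmx v u (- b).
Proof.
have us : lfrac v / lfrac u \is a GRing.unit.
  by rewrite unitrM unitrV !lfrac_unit.
rewrite affmxV // /stepmx invrM ?unitrV // invrK /Defs.cst polyCN rmorphN.
congr affmx; rewrite mulNr; congr (- _).
rewrite [LHS](_ : _ = lfrac u / lfrac u * (cst b / lfrac v)).
  by rewrite divrr ?mul1r.
by rewrite /Defs.cst; ring.
Qed.

Lemma lfrac_some i : lfrac (Some i) = tplus lam i.
Proof. by rewrite tplusE. Qed.

Lemma lfrac_none : lfrac None = 1.
Proof. by rewrite /lfrac rmorph1. Qed.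

Local Notation gens := (@gamma_gens L m lam).

(** The three families climb at infinity, descend at infinity, or move between two finite trees. *)
Lemma gens_step (g : Gamma lam) : gens g <->
  exists u v b, u != v /\ Gamma_mx g = stepmx u v b.
Proof.
have down i b : affmx (tplus lam i) (cst b) = stepmx None (Some i) b.
  by rewrite /stepmx lfrac_none lfrac_some !divr1.
have across i j b : affmx (tplus lam i * (tplus lam j)^-1)
    (- cst b * (tplus lam j)^-1) = stepmx (Some j) (Some i) (- b).
  by rewrite /stepmx !lfrac_some /Defs.cst polyCN rmorphN.
split.
  case=> [[i [b ->]]|[[i [b ->]]|[i [j [b [ij ->]]]]]].
  - by exists None, (Some i), b; rewrite down.
  - by exists (Some i), None, (- b); rewrite down stepmx_inv.
  - by exists (Some j), (Some i), (- b); rewrite across eq_sym.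
case=> -[j|] [[i|] [b [// uv e]]].
- by right; right; exists i, j, (- b); rewrite across opprK eq_sym.
- by right; left; exists j, (- b); rewrite down stepmx_inv opprK.
- by left; exists i, b; rewrite down.
Qed.

Lemma letters_step (g : Gamma lam) : letters gens g <->
  exists u v b, u != v /\ Gamma_mx g = stepmx u v b.
Proof.
split=> [[/gens_step//|/gens_step[u [v [b [uv e]]]]]|]; last first.
  by move/gens_step; left.
exists v, u, (- b); rewrite eq_sym; split=> //.
by rewrite -stepmx_inv -e -[in LHS](invgK g).
Qed.

Lemma word_steps (x : seq (Gamma lam)) : word_over gens x ->
  exists w, [/\ size w = size x, valid w &
    Gamma_mx (wprod x) = affmx (slope w) (disp w)].
Proof.
elim: x => [|g x IH] xS.
  by exists [::]; split=> //; rewrite /wprod /slope !big_nil affmx1.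
have [|w [sw vw ew]] := IH.
  by move=> s sx; apply: xS; rewrite inE sx orbT.
have [|u [v [b [uv eg]]]] := (letters_step g).1.
  by apply: xS; rewrite inE eqxx.
exists ((u, v, b) :: w); split=> /=; [by rewrite sw|by rewrite uv|].
rewrite /wprod big_cons -/(wprod x).
by rewrite -[LHS]/(Gamma_mx g *m Gamma_mx (wprod x)) eg ew affmxM slope_cons.
Qed.

Lemma steps_word (w : seq step) : valid w ->
  exists x : seq (Gamma lam), [/\ size x = size w, word_over gens x &
    Gamma_mx (wprod x) = affmx (slope w) (disp w)].
Proof.
elim: w => [|[[u v] b] w IH] /=.
  by exists [::]; split=> //; rewrite /wprod /slope !big_nil affmx1.
move=> /andP[/= uv /IH [x [sx xS ex]]].
have h : in_Gamma (stepmx u v b).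
  have := slope_tmon [:: (u, v, b)]; rewrite /slope big_seq1 /= => es.
  by rewrite /stepmx es; eexists; eexists.
pose g : Gamma lam := MkGamma (asboolT h).
exists (g :: x); split=> /=; first by rewrite sx.
  move=> s; rewrite inE => /predU1P[->|/xS//].
  by apply/letters_step; exists u, v, b.
rewrite /wprod big_cons -/(wprod x).
by rewrite -[LHS]/(Gamma_mx g *m Gamma_mx (wprod x)) ex affmxM slope_cons.
Qed.

Lemma dead_end_depth (m_gt0 : (0 < m)%N) (N : nat) : (0 < N)%N ->
  exists g : Gamma lam, dead_end (gamma_gen_set lam m_gt0) g /\
    exists k : nat, has_depth (gamma_gen_set lam m_gt0) g k /\ (N <= k)%N.
Proof.
move=> N_gt0; set S := gamma_gen_set lam m_gt0.
have lengthP g : exists w, [/\ size w = word_length S g, valid w &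
    Gamma_mx g = affmx (slope w) (disp w)].
  rewrite /word_length; case: ex_minnP => n /asboolP[x [<- xS <-]] _.
  exact: word_steps.
have length_le (g : Gamma lam) w : valid w ->
    Gamma_mx g = affmx (slope w) (disp w) -> (word_length S g <= size w)%N.
  move=> /steps_word[x [sx xS ex]] eg.
  rewrite /word_length; case: ex_minnP => n _; apply; apply/asboolP; exists x.
  by split=> //; apply: val_inj; exact: etrans ex (esym eg).
(* [M >= 2] lets [depth_M] cover single letters; the factor [m.+1] gives [m * M <= n] and [M <= n]
   for [reach_ball]. *)
pose M := maxn N 2; pose n := (m.+1 * M)%N.
have n_gt0 : (0 < n)%N by rewrite /n /M; nia.
have [D VD deepD] := deep_fraction m_gt0 n_gt0.
have hD : in_Gamma (affmx 1 D) by exists (fun=> 0), D; rewrite tmon0.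
pose g : Gamma lam := MkGamma (asboolT hD).
have len_g : (m.+3 * n <= word_length S g)%N.
  have [w [<- vw /affmx_inj[/esym sw dw]]] := lengthP g.
  by apply: deep_size => //; rewrite -dw.
have depth_M : depth_bound S g M.
  move=> x /word_steps[w [sw vw ew]] /andP[_ ltM].
  apply: leq_trans len_g.
  pose r : {ffun tree -> int} := [ffun a => (downs a w)%:Z - (ups a w)%:Z].
  have [||||a|T leT [w' [sw' vw' dw' rw']]] :=
    @reach_ball n M r (disp w + D) m_gt0.
  - by rewrite /n; nia.
  - by rewrite /n; nia.
  - apply: V_add => //; apply: disp_V => // k a; rewrite ffunE.
    rewrite (leq_trans (ups_size _ _)) // size_take_min.
    rewrite (leq_trans (geq_minr _ _)) // sw (leq_trans (ltnW ltM)) //.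
    by rewrite (leq_trans (leq_pmull M (ltn0Sn m))) // leq_addr.
  - under eq_bigr do rewrite ffunE.
    rewrite sumrB -!(big_morph Posz PoszD (erefl 0%:Z)).
    by rewrite sum_ups sum_downs subrr.
  - rewrite ffunE; have := ups_size a w; have := downs_size a w.
    by rewrite sw; move: (size x) ltM => y; lia.
  apply: leq_trans leT; rewrite -sw'; apply: length_le => //.
  rewrite -[LHS]/(Gamma_mx g *m Gamma_mx (wprod x)) ew affmxM mul1r dw' mul1r.
  congr affmx; rewrite !slope_tmon; apply: eq_bigr => i _.
  by rewrite -rw' ffunE.
(* A word descending [l.+1] times in one tree leads to an element longer than [g], as its slope
   forces that many descents. Hence the depth is finite. *)
have depth_fin k : depth_bound S g k -> (k <= (word_length S g).+1)%N.
  move=> gk; rewrite leqNgt; apply/negP => lt_k.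
  set l := word_length S g in lt_k.
  pose i0 := Ordinal m_gt0.
  pose w0 : seq step := nseq l.+1 (None, Some i0, 0).
  have [|x [sx xS ex]] := @steps_word w0.
    by rewrite /valid all_nseq.
  have := gk x xS; rewrite sx size_nseq => /(_ lt_k); rewrite -/l.
  have [w [<- vw]] := lengthP (g * wprod x)%g.
  rewrite -[LHS]/(Gamma_mx g *m Gamma_mx (wprod x)) ex affmxM mul1r.
  move=> /affmx_inj[sw _].
  suff : (l.+1 <= downs (Some i0) w)%N.
    by have := downs_size (Some i0) w; lia.
  have sw0 : slope w0 = lfrac (Some i0) ^+ l.+1.
    rewrite /slope /w0; elim: l.+1 => [|j IH] /=; first by rewrite big_nil.
    by rewrite big_cons IH lfrac_none divr1 exprS.
  have := slope_sden w; rewrite -sw sw0 -rmorphXn -rmorphM => /ofpoly_inj.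
  rewrite -sden_single -sdenD => /(congr1 ( *%R 1)) /esym e.
  have := @sden_pole _ _ _ _ i0 e; rewrite hornerC unitr1 !ffunE eqxx.
  by move=> /(_ isT); apply: leq_trans; rewrite leq_addr.
exists g; split.
  move=> s Ss; have := depth_M [:: s]; rewrite /wprod big_seq1; apply.
    by move=> t; rewrite inE => /eqP ->.
  by rewrite /= /M; lia.
have ex_depth : exists k, `[< depth_bound S g k >] by exists M; apply/asboolP.
have ub k : `[< depth_bound S g k >] -> (k <= (word_length S g).+1)%N.
  by move/asboolP/depth_fin.
case: (ex_maxnP ex_depth ub) => k /asboolP gk kmax.
exists k; split; first by split=> // k' gk'; apply: kmax; apply/asboolP.
by apply: leq_trans (kmax M _); [rewrite leq_maxl|apply/asboolP].
Qed.

End HorocyclicProduct.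

Theorem theorem12 (d q : nat) (hd : (2 <= d)%N) (hq : (2 <= q)%N)
    (hdq : (d = 2 \/ d = 3) \/
      ((4 <= d)%N /\ forall p : nat, prime p -> (p %| q)%N -> (d - 1 < p)%N))
    (L : finComUnitRingType) (hL : #|L| = q)
    (lam : 'I_d.-1 -> L) (lam_inj : injective lam)
    (lam_unit : (3 <= d)%N ->
      forall i j : 'I_d.-1, i != j -> (lam i - lam j)%R \is a GRing.unit)
    (N : nat) (hN : (0 < N)%N) :
  exists g : Gamma lam, dead_end (S_dq hd lam) g /\
    exists k : nat, has_depth (S_dq hd lam) g k /\ (N <= k)%N.
Proof.
apply: dead_end_depth hN => i j ij; apply: lam_unit => //.
(* Two distinct indices below [d.-1] force [3 <= d]. *)
have := ltn_ord i; have := ltn_ord j; move: ij; rewrite -(inj_eq val_inj) /=.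
lia.
Qed.
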